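(* Let $K = \langle S, AP, \to, L\rangle$ be a Kripke structure. For all states $s, s' \in S$: $s$ and $s'$ are trace equivalent in $K$ if and only if $s$ and $s'$ are completed trace equivalent in the labelled transition system $\mathsf{lts}(K)$.
   Context: A Kripke structure is $K=\langle S, AP, \to, L\rangle$ with $S$ a set of states, $AP$ a set of atomic propositions, $\to\,\subseteq S\times S$ a total transition relation (for every $s\in S$ there is $t\in S$ with $s\to t$), and $L: S\to 2^{AP}$ a state labelling. A labelled transition system (LTS) is $T=\langle S, Act, \to\rangle$ with $S$ a set of states, $Act$ a set of actions, a special silent action $\tau\notin Act$, and a transition relation $\to\,\subseteq S\times(Act\cup\{\tau\})\times S$ that is total (for every $s\in S$ there are $a\in Act$, $t\in S$ with $s\xrightarrow{a}t$). The embedding $\mathsf{lts}$: for a Kripke structure $K=\langle S,AP,\to,L\rangle$, $\mathsf{lts}(K)=\langle S', Act, \to'\rangle$ where $S' = S\cup\{\bar s \mid s\in S\}$ (each $\bar s$ a fresh state not in $S$), $Act = 2^{AP}\cup\{\bot\}$ with $\bot$ a fresh symbol, and $\to'$ is the smallest relation such that: $s\xrightarrow{\bot}\bar s$ for every $s\in S$; $\bar s\xrightarrow{L(s)} s$ for every $s\in S$; $s\xrightarrow{\tau}t$ whenever $s\to t$ and $L(s)=L(t)$; $s\xrightarrow{L(t)}t$ whenever $s\to t$ and $L(s)\neq L(t)$. Trace equivalence in a Kripke structure: a path from $s$ is an infinite sequence $s_0 s_1\ldots$ of states with $s_0=s$ and $s_i\to s_{i+1}$ for all $i$; its trace is the infinite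 sequence $L(s_0)L(s_1)\ldots$; states $s,s'$ are trace equivalent iff the set of traces of paths from $s$ equals the set of traces of paths from $s'$. Completed trace equivalence in an LTS: a run from $s$ is an infinite alternating sequence $s_0 a_0 s_1 a_1\ldots$ with $s_0=s$ and $s_i\xrightarrow{a_i}s_{i+1}$ for all $i$ (the $a_i$ range over $Act\cup\{\tau\}$); its trace is the infinite sequence $a_0a_1\ldots$ (with $\tau$'s included); states $s,s'$ are completed trace equivalent iff the set of traces of runs from $s$ equals the set of traces of runs from $s'$. *)

(* Defs.v *)
From mathcomp Require Import all_boot.
From mathcomp Require Import boolp classical_sets.

Set Implicit Arguments.
Unset Strict Implicit.
Unset Printing Implicit Defensive.

Local Open Scope classical_set_scope.

Record kripke := Kripke {
  kstate : Type;
  kprop : Type;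
  ktrans : kstate -> kstate -> Prop;
  ktrans_total : forall s, exists t, ktrans s t;
  klabel : kstate -> set kprop
}.

(* The disjoint union of Act and {tau}. *)
Inductive with_tau (A : Type) : Type :=
| Tau
| Vis of A.
Arguments Tau {A}.

(* Totality asks for a step labelled in Act, that is, a non-silent one. *)
Record LTS := MkLTS {
  lstate : Type;
  lact : Type;
  ltrans : lstate -> with_tau lact -> lstate -> Prop;
  ltrans_total : forall s, exists (a : lact) t, ltrans s (Vis a) t
}.

Section KripkeTraces.
Variable K : kripke.

Definition is_path (s : kstate K) (p : nat -> kstate K) : Prop :=
  p 0 = s /\ forall i, ktrans (p i) (p i.+1).

Definition path_trace (p : nat -> kstate K) : nat -> set (kprop K) :=
  fun i => klabel (p i).

Definition ktraces (s : kstate K) : set (nat -> set (kprop K)) :=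
  [set w | exists2 p, is_path s p & w = path_trace p].

Definition trace_equivalent (s s' : kstate K) : Prop :=
  ktraces s = ktraces s'.

End KripkeTraces.

Section LTSTraces.
Variable T : LTS.

(* The alternating sequence s_0 a_0 s_1 a_1 ... is given by its two
   subsequences, the states r and the actions a. *)
Definition is_run (s : lstate T) (r : nat -> lstate T)
    (a : nat -> with_tau (lact T)) : Prop :=
  r 0 = s /\ forall i, ltrans (r i) (a i) (r i.+1).

Definition ltraces (s : lstate T) : set (nat -> with_tau (lact T)) :=
  [set a | exists r, is_run s r a].

Definition completed_trace_equivalent (s s' : lstate T) : Prop :=
  ltraces s = ltraces s'.

End LTSTraces.

(* S together with the fresh copies of its elements. *)
Inductive emb_state (S : Type) : Type :=
| Orig of S
| Bar of S.

(* 2^AP together with the fresh symbol bot. *)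
Inductive emb_act (AP : Type) : Type :=
| Bot
| Lab of set AP.
Arguments Bot {AP}.

Inductive emb_trans (K : kripke) :
    emb_state (kstate K) -> with_tau (emb_act (kprop K)) ->
    emb_state (kstate K) -> Prop :=
| emb_bot s : emb_trans (Orig s) (Vis Bot) (Bar s)
| emb_bar s : emb_trans (Bar s) (Vis (Lab (klabel s))) (Orig s)
| emb_tau s t : ktrans s t -> klabel s = klabel t ->
    emb_trans (Orig s) Tau (Orig t)
| emb_lab s t : ktrans s t -> klabel s <> klabel t ->
    emb_trans (Orig s) (Vis (Lab (klabel t))) (Orig t).

Lemma emb_trans_total (K : kripke) (s : emb_state (kstate K)) :
  exists (a : emb_act (kprop K)) t, emb_trans s (Vis a) t.
Proof.
case: s => s.
- by exists Bot, (Bar s); constructor.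
- by exists (Lab (klabel s)), (Orig s); constructor.
Qed.

Definition lts (K : kripke) : LTS :=
  {| lstate := emb_state (kstate K);
     lact := emb_act (kprop K);
     ltrans := @emb_trans K;
     ltrans_total := @emb_trans_total K |}.

(* Main.v *)
Require Import Defs.
From mathcomp Require Import all_boot.
From mathcomp Require Import boolp classical_sets.

(** A run of [lts K] projects, by forgetting bars, to a stuttering sequence of
states of [K] that moves exactly on the steps between two unbarred states.
Replacing the underlying path by any path with the same trace, while keeping
the same bars and the same stuttering, leaves all actions unchanged.
Conversely, the run that first visits the bar of [s] and then follows a path
exhibits the label of [s]; after that, [Tau] means "same label" and [Lab A]
means "the label becomes [A]", so any run with the same actions follows a path
with the same trace. *)

Set Implicit Arguments.
Unset Strict Implicit.
Unset Printing Implicit Defensive.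

Local Open Scope classical_set_scope.

(* The moves may be finitely many; totality of [R] then supplies the tail. *)
Lemma destutter (T : Type) (R : T -> T -> Prop) (u : nat -> T)
    (b : nat -> bool) :
  (forall x, exists y, R x y) ->
  (forall i, if b i then R (u i) (u i.+1) else u i.+1 = u i) ->
  exists p : nat -> T,
    (forall n, R (p n) (p n.+1)) /\ forall i, u i = p (\sum_(k < i) b k).
Proof.
move=> /choice[f Rf] step; pose c i := \sum_(k < i) b k.
have cS i : c i.+1 = c i + b i by rewrite /c big_ord_recr.
have c0 : c 0 = 0 by rewrite /c big_ord0.
have c_le i d : c i <= c (i + d).
  elim: d => [|d IH]; first by rewrite addn0.
  by rewrite addnS cS (leq_trans IH) ?leq_addr.
(* A move in between would push the count strictly above [c i], so [u] only stutters there. *)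
have u_cD i d : c (i + d) = c i -> u (i + d) = u i.
  elim: d => [|d IH]; first by rewrite addn0.
  rewrite addnS cS; have := step (i + d); case: (b _) => [_|->].
    by rewrite addn1 => e; have := c_le i d; rewrite -e ltnn.
  by rewrite addn0.
have u_c i j : c i = c j -> u i = u j.
  by case: (leqP i j) => [|/ltnW] /subnKC <- => [/esym|] /u_cD.
(* The count starts at 0 and rises by at most one, so it must cross from [n] to [n.+1], and it does
   so at a move. *)
have c_hit n j : c j = n.+1 -> exists2 i, c i = n & R (u i) (u i.+1) /\ c i.+1 = n.+1.
  elim: j => [|j IH]; first by rewrite c0.
  rewrite cS; have := step j; have := cS j.
  case: (b j) => [cj Rj|_ _]; last by rewrite addn0.
  by rewrite addn1 => -[e]; exists j; rewrite // cj e addn1.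
(* Which [j] is picked is immaterial by [u_c]; once the moves of [u] are exhausted, [f] continues
   the path. *)
pose next n x := if pselect (exists j, c j = n.+1) is left h
                 then u (sval (cid h)) else f x.
pose p := fix p n := if n is m.+1 then next m (p m) else u 0.
have pE i n : c i = n -> p n = u i.
  case: n => [|n] cin /=; first by apply: u_c; rewrite c0 cin.
  rewrite /next; case: pselect => [h|[]]; last by exists i.
  by apply: u_c; case: (cid h) => j /= ->.
exists p; split=> [n|i]; last by rewrite (pE i).
have [[j /c_hit[i ci [Ri ciS]]]|nh] := pselect (exists j, c j = n.+1).
  by rewrite (pE i) // (pE i.+1).
by rewrite /= /next; case: pselect.
Qed.

Definition is_orig (S : Type) (x : emb_state S) : bool :=
  if x is Orig _ then true else false.

Definition base (S : Type) (x : emb_state S) : S :=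
  match x with Orig s => s | Bar s => s end.

Definition rebase (S : Type) (x : emb_state S) (s : S) : emb_state S :=
  if is_orig x then Orig s else Bar s.

Lemma emb_trans_base (K : kripke) x a y :
  @emb_trans K x a y ->
  if is_orig x && is_orig y then ktrans (base x) (base y) else base y = base x.
Proof. by case. Qed.

(** An action depends only on the bars and labels of its endpoints, not on the states themselves. *)
Lemma emb_trans_rebase (K : kripke) x a y (s t : kstate K) :
  emb_trans x a y ->
  klabel (base x) = klabel s -> klabel (base y) = klabel t ->
  (if is_orig x && is_orig y then ktrans s t else t = s) ->
  emb_trans (rebase x s) a (rebase y t).
Proof.
case=> [z|z|z w _ e|z w _ ne] /= ls lt; rewrite /rebase /=.
- by move=> ->; constructor.
- by move=> ->; rewrite ls; constructor.
- by move=> st; apply: emb_tau; rewrite // -ls -lt.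
- by move=> st; rewrite lt; apply: emb_lab; rewrite // -ls -lt.
Qed.

Lemma ktraces_sub_ltraces (K : kripke) (s s' : kstate K) :
  ktraces s `<=` ktraces s' ->
  @ltraces (lts K) (Orig s) `<=` @ltraces (lts K) (Orig s').
Proof.
move=> sub a [r [r0 rS]].
have [p [pS pE]] := @destutter _ (@ktrans K) (fun i => base (r i))
  (fun i => is_orig (r i) && is_orig (r i.+1)) (@ktrans_total K)
  (fun i => emb_trans_base (rS i)).
have p0 : p 0 = s by have := pE 0; rewrite big_ord0 r0.
have [q [q0 qS] pq] : ktraces s' (path_trace p) by apply: sub; exists p.
have lpq n : klabel (p n) = klabel (q n) by have := congr1 (@^~ n) pq.
pose c i := \sum_(k < i) (is_orig (r k) && is_orig (r k.+1)).
(* The new run keeps the bars of [r] and advances along [q] exactly when [r] steps between unbarred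
   states. *)
exists (fun i => rebase (r i) (q (c i))); split.
  by rewrite /c big_ord0 q0 r0.
move=> i; apply: emb_trans_rebase (rS i) _ _ _; rewrite ?pE ?lpq //.
rewrite /c big_ord_recr /=; case: (_ && _); last by rewrite addn0.
by rewrite addn1.
Qed.

Definition step_act (AP : Type) (A B : set AP) : with_tau (emb_act AP) :=
  if pselect (A = B) then Tau else Vis (Lab B).

Lemma emb_trans_step_act (K : kripke) (s t : kstate K) :
  ktrans s t -> emb_trans (Orig s) (step_act (klabel s) (klabel t)) (Orig t).
Proof.
by rewrite /step_act; case: pselect => e st; [apply: emb_tau|apply: emb_lab].
Qed.

(** [step_act] is never [Bot], so [y] is unbarred; as the label of [s] is known, both [Tau] and
    [Lab B] determine the label of [y]. *)
Lemma emb_trans_step_act_inv (K : kripke) (s : kstate K) B y :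
  emb_trans (Orig s) (step_act (klabel s) B) y ->
  exists t, [/\ y = Orig t, klabel t = B & ktrans s t].
Proof.
rewrite /step_act; case: pselect => e h; inversion h; subst.
- by exists t; split.
- by exists t; split.
Qed.

Lemma ltraces_sub_ktraces (K : kripke) (s s' : kstate K) :
  @ltraces (lts K) (Orig s) `<=` @ltraces (lts K) (Orig s') ->
  ktraces s `<=` ktraces s'.
Proof.
move=> sub _ [p [p0 pS] ->].
(* Without the initial detour, paths with different constant labels would all give only [Tau]. *)
pose a n := match n with
  | 0 => Vis Bot
  | 1 => Vis (Lab (klabel s))
  | n.+2 => step_act (klabel (p n)) (klabel (p n.+1))
  end.
have [r [r0 rS]] : @ltraces (lts K) (Orig s') a.
  apply: sub; exists (fun n => match n with
    | 0 => Orig s | 1 => Bar s | n.+2 => Orig (p n) end).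
  split=> // -[|[|n]]; [exact: emb_bot|rewrite p0; exact: emb_bar|].
  exact: emb_trans_step_act.
have r1 : r 1 = Bar s'.
  by have := rS 0; rewrite r0 /= => h; inversion h.
have [r2 ls] : r 2 = Orig s' /\ klabel s' = klabel s.
  by have := rS 1; rewrite r1 /= => h; inversion h.
(* The label equality is part of the induction: it turns the action read off [p] into a [step_act]
   from the label of [x]. *)
have /choice[q qE] n : exists x, r n.+2 = Orig x /\ klabel x = klabel (p n).
  elim: n => [|n [x [rx lx]]]; first by exists s'; rewrite p0.
  have := rS n.+2; rewrite rx /= -lx => /emb_trans_step_act_inv[t [-> lt _]].
  by exists t.
exists q; last by apply/funext => n; rewrite /path_trace (qE n).2.
split=> [|n]; first by have := (qE 0).1; rewrite r2 => -[].
have := rS n.+2; rewrite (qE n).1 /= -(qE n).2.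
by move=> /emb_trans_step_act_inv[t [+ _ +]]; rewrite (qE n.+1).1 => -[->].
Qed.

Theorem theorem3p19 (K : kripke) (s s' : kstate K) :
  trace_equivalent s s' <->
  @completed_trace_equivalent (lts K) (Orig s) (Orig s').
Proof.
rewrite /trace_equivalent /completed_trace_equivalent.
split=> e; apply/seteqP; split.
- by apply: ktraces_sub_ltraces; rewrite e.
- by apply: ktraces_sub_ltraces; rewrite e.
- by apply: ltraces_sub_ktraces; rewrite e.
- by apply: ltraces_sub_ktraces; rewrite e.
Qed.
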